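(* Let $\rho,\sigma$ be density matrices on a finite-dimensional Hilbert space with $\rho\succ\sigma$, and put $\Delta M_n=M^{(n)}(\sigma;n-1)-M^{(n)}(\rho;n-1)$ for $n=2,3,4$. Assume $\Delta M_2\neq 0$. Then $$\Delta M_4\ \ge\ 8\,\Delta M_3-6\,\Delta M_2+\frac89\,\frac{(\Delta M_3-3\,\Delta M_2)^2}{\Delta M_2}.$$
   Context: For an integer $n\ge 1$ and a density matrix $\rho$, $M^{(n)}(\rho;n-1)=\mathrm{Tr}\big[\rho(-\ln\rho+n-1)^n\big]-(n-1)^n$ (zero eigenvalues contribute $0$ to the trace). Majorization: for density matrices $\rho_1,\rho_2$ of the same dimension $d$ with eigenvalues in decreasing order $\lambda_1\ge\dots\ge\lambda_d$ and $\kappa_1\ge\dots\ge\kappa_d$, $\rho_1\succ\rho_2$ means $\sum_{k=1}^m\lambda_k\ge\sum_{k=1}^m\kappa_k$ for all $m=1,\dots,d$. *)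

(* Defs.v *)
From mathcomp Require Import all_boot all_order all_algebra.
From mathcomp Require Import complex.
From mathcomp Require Import reals exp.

Set Implicit Arguments.
Unset Strict Implicit.
Unset Printing Implicit Defensive.

Import Order.TTheory GRing.Theory Num.Theory.
Local Open Scope ring_scope.
Local Open Scope complex_scope.
Local Open Scope sesquilinear_scope.

(* A d-dimensional Hilbert space is identified with C^d, where C := R[i]; an   *)
(* operator is its matrix in an orthonormal basis.                             *)
Definition density_matrix (R : realType) (d : nat) (rho : 'M[R[i]]_d) : Prop :=
  [/\ rho \is hermsymmx,
      forall v : 'rV[R[i]]_d, 0 <= (v *m rho *m v ^t* ) 0 0
    & \tr rho = 1].

(* Functional calculus f(A) for Hermitian A: spectralmx A is unitary and       *)
(* spectral_diag A lists the (real) eigenvalues with multiplicity.             *)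
Definition funmx (R : realType) (d : nat) (f : R -> R) (A : 'M[R[i]]_d) :
    'M[R[i]]_d :=
  (spectralmx A) ^t* *m
  diag_mx (map_mx (fun z : R[i] => (f (complex.Re z))%:C) (spectral_diag A)) *m
  spectralmx A.

(* Tr[rho (- ln rho + b)^n] - b^n. Since ln 0 = 0 in the library, the matrix   *)
(* logarithm is finite on the kernel of rho, and the factor rho makes zero     *)
(* eigenvalues contribute 0 to the trace. The trace is real because rho        *)
(* commutes with ln rho, so taking its real part loses nothing.                *)
Definition entropic_moment (R : realType) (d n : nat) (rho : 'M[R[i]]_d)
    (b : R) : R :=
  complex.Re (\tr (rho *m (- funmx (@ln R) rho + (b%:C)%:M) ^+ n)) - b ^+ n.

(* The eigenvalues of a Hermitian matrix, with multiplicity, decreasing.       *)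
Definition eigenvalues (R : realType) (d : nat) (A : 'M[R[i]]_d) : seq R :=
  sort >=%R [seq complex.Re (spectral_diag A 0 i) | i : 'I_d].

Definition majorizes (R : realType) (d : nat) (rho sigma : 'M[R[i]]_d) : Prop :=
  forall m : nat, (1 <= m <= d)%N ->
    \sum_(k < m) (eigenvalues sigma)`_k <= \sum_(k < m) (eigenvalues rho)`_k.

Definition moment_gap (R : realType) (d : nat) (rho sigma : 'M[R[i]]_d)
    (n : nat) : R :=
  entropic_moment n sigma (n%:R - 1) - entropic_moment n rho (n%:R - 1).

(* Main.v *)
(* For H(x) = x G(- ln x) with G a polynomial, H'(x) = P(- ln x) where
   P = G - G'. For every real k a suitable combination G of (X + n - 1)^n,
   n = 4, 3, 2, has P' = 4 X (X + 3 - k)^2, so H is concave on [0, 1] and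
   Karamata's inequality gives
     M4 - (8/3) k M3 + 2 (k^2 - 2 k) M2 >= 0,
   where Mn is the gap of the n-th moment. The theorem is the case
   k = (2 M3 + 3 M2) / (3 M2), the stationary point of this quadratic. *)
Require Import Defs.
From mathcomp Require Import all_boot all_order all_algebra.
From mathcomp Require Import complex.
From mathcomp Require Import reals exp.
From mathcomp Require Import classical_sets topology normedtype sequences derive ring lra.

Set Implicit Arguments.
Unset Strict Implicit.
Unset Printing Implicit Defensive.

Import Order.TTheory GRing.Theory Num.Theory.
Import numFieldNormedType.Exports numFieldTopology.Exports.

Local Open Scope ring_scope.
Local Open Scope complex_scope.
Local Open Scope sesquilinear_scope.

(** * Karamata's inequality for majorized sequences *)

Section Majorization.
Variables (R : realFieldType).
Implicit Types (c x lam kap : nat -> R) (n : nat).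

(** Summation by parts, done inductively: the nonnegative partial sum up to [n] may have its weight
    [c n] raised to [c n.+1] before the next term joins. *)
Lemma abel_sum_le c x n :
  (forall i j, (i <= j <= n)%N -> c i <= c j) ->
  (forall m, (m <= n.+1)%N -> 0 <= \sum_(i < m) x i) ->
  \sum_(i < n.+1) c i * x i <= c n * \sum_(i < n.+1) x i.
Proof.
elim: n => [|n IHn] c_nd S_ge0; first by rewrite !big_ord1.
rewrite big_ord_recr [in leRHS]big_ord_recr mulrDr /= lerD2r.
apply: le_trans (IHn _ _) _ => [i j /andP[ij jn]|m mn|].
- by apply: c_nd; rewrite ij leqW.
- by apply: S_ge0; rewrite leqW.
- by apply: ler_wpM2r; [exact: S_ge0 | apply: c_nd; rewrite leqnSn leqnn].
Qed.

(* Needed because the tangent of H at 0 may be vertical. *)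
Lemma majorized_zero lam kap d (i : nat) :
  (forall i, (i < d)%N -> 0 <= lam i) ->
  (forall i j, (i <= j < d)%N -> kap j <= kap i) ->
  (forall i, (i < d)%N -> 0 <= kap i) ->
  (forall m, (m <= d)%N -> \sum_(i < m) kap i <= \sum_(i < m) lam i) ->
  \sum_(i < d) kap i = \sum_(i < d) lam i ->
  (i < d)%N -> kap i = 0 -> lam i = 0.
Proof.
move=> lam0 kapd kap0 maj tot id ki0.
have split_sum (f : nat -> R) : \sum_(j < d) f j = \sum_(j < i) f j + \sum_(i <= j < d) f j.
  by rewrite -(big_mkord predT f) (big_cat_nat (n := i)) ?(ltnW id) //= big_mkord.
have tail0 : \sum_(i <= j < d) kap j = 0.
  rewrite big_nat big1 // => j /andP[ij jd]; apply/le_anti.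
  by rewrite kap0 // andbT -ki0 kapd ?ij.
(* The totals agree and the head of [lam] dominates that of [kap], so the tail of [lam] is at most
   the vanishing tail of [kap]. *)
have lam_tail : \sum_(i <= j < d) lam j <= 0.
  by move: tot (maj i (ltnW id)); rewrite !split_sum tail0; lra.
apply/le_anti; rewrite lam0 // andbT; apply: le_trans lam_tail.
rewrite big_ltn // lerDl big_nat sumr_ge0 // => j /andP[_ jd]; exact: lam0.
Qed.

(** Sum the tangent inequalities at the points [kap i]. The slopes increase with [i] because [kap]
    decreases, so [abel_sum_le] bounds the sum by the last slope times the difference of totals,
    which is 0. *)
Lemma karamata (H slope : R -> R) lam kap d :
  (forall x y : R, 0 <= x <= 1 -> 0 < y <= 1 -> H x <= H y + slope y * (x - y)) ->
  (forall x y : R, 0 < x <= y -> y <= 1 -> slope y <= slope x) ->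
  (forall i, (i < d)%N -> 0 <= lam i <= 1) ->
  (forall i j, (i <= j < d)%N -> kap j <= kap i) ->
  (forall i, (i < d)%N -> 0 <= kap i <= 1) ->
  (forall m, (m <= d)%N -> \sum_(i < m) kap i <= \sum_(i < m) lam i) ->
  \sum_(i < d) kap i = \sum_(i < d) lam i ->
  \sum_(i < d) H (lam i) <= \sum_(i < d) H (kap i).
Proof.
move=> tangent slope_ni lam01 kapd kap01 maj tot.
have kap_gt0 i : (i < d)%N -> kap i != 0 -> 0 < kap i <= 1.
  by move=> /kap01/andP[k0 ->]; rewrite lt_def k0 andbT => ->.
case: d => [|d] in lam01 kapd kap01 maj tot kap_gt0 *; first by rewrite !big_ord0.
(* B stands for the slope at 0: any upper bound of the other slopes will do. *)
pose B := \sum_(i < d.+1) `|slope (kap i)|.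
pose c i := if kap i == 0 then B else slope (kap i).
have H_le i : (i < d.+1)%N -> H (lam i) - H (kap i) <= c i * (lam i - kap i).
  move=> id; rewrite /c; case: eqP => [ki0|/eqP ki0].
    have li0 : lam i = 0.
      apply: (@majorized_zero lam kap d.+1 i) => //.
      - by move=> j /lam01/andP[].
      - by move=> j /kap01/andP[].
    by rewrite ki0 li0 !subrr mulr0.
  by rewrite lerBlDl tangent ?kap_gt0 ?lam01.
have c_nd i j : (i <= j <= d)%N -> c i <= c j.
  move=> /andP[ij jd]; have kij : kap j <= kap i by rewrite kapd ?ij.
  have id : (i < d.+1)%N by rewrite ltnS (leq_trans ij).
  rewrite /c; case: (eqVneq (kap i) 0) => [ki0|ki0].
    have -> : kap j = 0 by apply/le_anti; rewrite -{1}ki0 kij; case/andP: (kap01 j jd).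
    by rewrite eqxx.
  case: eqP => [_|/eqP kj0]; last first.
    by case/andP: (kap_gt0 j jd kj0) => kj _; apply: slope_ni; rewrite ?kj //; case/andP: (kap01 i id).
  apply: le_trans (ler_norm _) _.
  by rewrite /B (bigD1 (Ordinal id)) //= lerDl sumr_ge0.
rewrite -subr_le0 -sumrB.
apply: (@le_trans _ _ (\sum_(i < d.+1) c i * (lam i - kap i))).
  by apply: ler_sum => i _; apply: H_le.
apply: le_trans (@abel_sum_le c (fun i => lam i - kap i) d c_nd _) _.
  by move=> m md; rewrite sumrB subr_ge0 maj.
by rewrite sumrB tot subrr mulr0.
Qed.

End Majorization.

(** * Concavity of [x * G.[- ln x]] through tangent inequalities *)

Section EntropicConcavity.
Variable R : realType.
Implicit Types (G : {poly R}) (x y u v k : R).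

(* The tangent inequality of H in the variable s = - ln x: it says that
   e^(-s) (G(s) - P(v)) is maximal at s = v. *)
Lemma entropic_tangent_log G u v :
  (forall s t : R, 0 <= s <= t -> (G - G^`()).[s] <= (G - G^`()).[t]) ->
  0 <= u -> 0 <= v ->
  expR (- u) * G.[u] <=
  expR (- v) * G.[v] + (G - G^`()).[v] * (expR (- u) - expR (- v)).
Proof.
move=> P_nd u0 v0; set p := (G - G^`()).[v].
pose phi s := expR (- s) * (G - p%:P).[s].
pose dphi s := expR (- s) * (p - (G - G^`()).[s]).
have phi_derive (s : R) : is_derive s (1 : R) phi (dphi s).
  rewrite /phi; apply: is_derive_eq.
  by rewrite /dphi derivB derivC subr0 !hornerE /GRing.scale /=; ring.
have phi_cont (a b : R) : ({within `[a, b], continuous phi})%classic.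
  apply: continuous_subspaceT => s; apply: differentiable_continuous.
  by apply/derivable1_diffP; case: (phi_derive s).
suff : phi u <= phi v by rewrite /phi !hornerE; lra.
case: (leP u v) => [uv|/ltW vu].
  have [s] := MVT_segment uv (fun x _ => phi_derive x) (phi_cont u v).
  rewrite in_itv /= => /andP[us sv] phiE; rewrite -subr_ge0 phiE.
  rewrite mulr_ge0 ?subr_ge0 // mulr_ge0 ?expR_ge0 // subr_ge0 P_nd //.
  by rewrite sv (le_trans u0).
have [s] := MVT_segment vu (fun x _ => phi_derive x) (phi_cont v u).
rewrite in_itv /= => /andP[vs su] phiE; rewrite -subr_le0 phiE.
rewrite mulr_le0_ge0 ?subr_ge0 // mulr_ge0_le0 ?expR_ge0 // subr_le0 P_nd //.
by rewrite v0.
Qed.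

Lemma entropic_tangent G x y :
  (forall s t : R, 0 <= s <= t -> (G - G^`()).[s] <= (G - G^`()).[t]) ->
  (forall s : R, 0 <= s -> 0 <= G^`().[s]) ->
  0 <= x <= 1 -> 0 < y <= 1 ->
  x * G.[- ln x] <= y * G.[- ln y] + (G - G^`()).[- ln y] * (x - y).
Proof.
move=> P_nd dG_ge0 /andP[x0 x1] /andP[y0 y1].
have Ly : 0 <= - ln y by rewrite oppr_ge0 ln_le0.
move: x0; rewrite le_eqVlt => /predU1P[<-|x0].
  rewrite mul0r sub0r mulrN hornerD hornerN mulrBl opprB addrC -addrA.
  by rewrite [y * _]mulrC addNr addr0 mulr_ge0 ?dG_ge0 // ltW.
have := @entropic_tangent_log G (- ln x) (- ln y) P_nd.
by rewrite !opprK !lnK // oppr_ge0 ln_le0 //; apply.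
Qed.

(** For [G = (X + n - 1)^n] one gets [G' - G'' = n X (X + n - 1)^(n - 2)]: the shift [n - 1] yields
    the factor [X], and the coefficients in [k] complete the remaining quadratic to a square. *)
Definition moment_poly k : {poly R} :=
  ('X + 3%:P) ^+ 4 - (8 / 3 * k) *: ('X + 2%:P) ^+ 3
  + (2 * (k ^+ 2 - 2 * k)) *: ('X + 1) ^+ 2.

Lemma moment_polyE k u : (moment_poly k).[u] =
  (u + 3) ^+ 4 - 8 / 3 * k * (u + 2) ^+ 3 + 2 * (k ^+ 2 - 2 * k) * (u + 1) ^+ 2.
Proof. by rewrite /moment_poly !(hornerE, horner_exp). Qed.

Lemma deriv_moment_polyE k u : (moment_poly k)^`().[u] =
  4 * (u + 3) ^+ 3 - 8 * k * (u + 2) ^+ 2 + 4 * (k ^+ 2 - 2 * k) * (u + 1).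
Proof.
by rewrite /moment_poly !poly.derivE !(hornerE, horner_exp) /=; field.
Qed.

Lemma deriv_moment_poly_ge0 k u : 0 <= u -> 0 <= (moment_poly k)^`().[u].
Proof.
move=> u0; rewrite deriv_moment_polyE.
(* The squares absorb the terms in [k]; what is left over is [4 * (u + 2)]. *)
have -> : 4 * (u + 3) ^+ 3 - 8 * k * (u + 2) ^+ 2 + 4 * (k ^+ 2 - 2 * k) * (u + 1)
  = 4 * (u * ((u + 4 - k) ^+ 2 + 1) + ((u + 5 - k) ^+ 2 + 2)) by ring.
by rewrite mulr_ge0 // addr_ge0 ?mulr_ge0 // addr_ge0 ?sqr_ge0.
Qed.

Lemma moment_poly_slope_nd k u v : 0 <= u <= v ->
  (moment_poly k - (moment_poly k)^`()).[u] <=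
  (moment_poly k - (moment_poly k)^`()).[v].
Proof.
move=> /andP[u0 uv]; have hornerB w := hornerD (moment_poly k) (- (moment_poly k)^`()) w.
rewrite -subr_ge0 !hornerB !hornerN !deriv_moment_polyE !moment_polyE; pose h := v - u; pose e := u + 3 - k.
have -> : v = u + h by rewrite /h; ring.
have -> : k = u + 3 - e by rewrite /e; ring.
have h0 : 0 <= h by rewrite subr_ge0.
(* This is the integral of [4 (u + t) (e + t)^2] over [t] from 0 to [h], with squares completed in
   [e]. *)
rewrite (_ : _ - _ = 4 * h * (u * ((e + h / 2) ^+ 2 + h ^+ 2 / 12)
   + h * (2^-1 * (e + 2 / 3 * h) ^+ 2 + h ^+ 2 / 36))); last by field.
have := sqr_ge0 h; have := sqr_ge0 (e + h / 2); have := sqr_ge0 (e + 2 / 3 * h) => *.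
by rewrite mulr_ge0 ?addr_ge0 // ?mulr_ge0 //; lra.
Qed.

End EntropicConcavity.

(** * Reduction of density matrices to their eigenvalues *)

Section Spectral.
Variables (R : realType) (d : nat).
Local Notation C := R[i].
Implicit Types (A rho sigma : 'M[C]_d) (n : nat) (b : R).

Lemma exp_unitary_conj (P : 'M[C]_d) (v : 'rV[C]_d) n : P \is unitarymx ->
  (P ^t* *m diag_mx v *m P) ^+ n =
  P ^t* *m diag_mx (\row_i v 0 i ^+ n) *m P.
Proof.
move=> /unitarymxP PPt; have PtP : P ^t* *m P = 1%:M by exact: mulmx1C.
elim: n => [|n IHn].
  rewrite expr0 (_ : diag_mx _ = 1%:M) ?mulmx1 ?PtP //.
  by apply/matrixP => i j; rewrite !mxE expr0.
rewrite exprS IHn -[_ * _]/(_ *m _) !mulmxA -(mulmxA _ P) PPt mulmx1.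
rewrite -(mulmxA (P ^t*)) mulmx_diag; congr (_ *m diag_mx _ *m _).
by apply/rowP => i; rewrite !mxE exprS.
Qed.

Lemma hermitian_spectral A : A \is hermsymmx ->
  A = (spectralmx A) ^t* *m
      diag_mx (\row_i (complex.Re (spectral_diag A 0 i))%:C) *m spectralmx A.
Proof.
move=> hA; have /orthomx_spectralP AE := hermitian_normalmx hA.
rewrite {1}AE invmx_unitary ?spectral_unitarymx //.
congr (_ *m diag_mx _ *m _); apply/rowP => i; rewrite mxE.
have /mxOverP/(_ 0 i) := hermitian_spectral_diag_real hA.
by move/RRe_real.
Qed.

Lemma mxtrace_unitary_conj (P : 'M[C]_d) (v : 'rV[C]_d) : P \is unitarymx ->
  \tr (P ^t* *m diag_mx v *m P) = \sum_i v 0 i.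
Proof.
by move=> /unitarymxP PPt; rewrite mxtrace_mulC mulmxA PPt mul1mx mxtrace_diag.
Qed.

Lemma entropic_moment_spectral rho n b : rho \is hermsymmx ->
  entropic_moment n rho b =
  \sum_i complex.Re (spectral_diag rho 0 i)
         * (- ln (complex.Re (spectral_diag rho 0 i)) + b) ^+ n - b ^+ n.
Proof.
move=> hrho; rewrite /entropic_moment; congr (_ - _).
set P := spectralmx rho; have uP : P \is unitarymx by exact: spectral_unitarymx.
have PPt := unitarymxP uP.
have PtP : P ^t* *m P = 1%:M by exact: mulmx1C.
(* The scalar matrix is conjugated by [P] too, so that [rho] and the power are diagonal in one
   basis. *)
have -> : - funmx (@ln R) rho + b%:C%:M = P ^t* *m
    diag_mx (\row_i (- ln (complex.Re (spectral_diag rho 0 i)) + b)%:C) *m P.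
  rewrite -[b%:C%:M]mulmx1 -PtP mulmxA -scalar_mxC.
  rewrite /funmx -/P -mulNmx -mulmxN -mulmxDl -mulmxDr; congr (_ *m _ *m _).
  apply/matrixP => i j; rewrite !mxE; case: eqP => _; last by rewrite !mulr0n oppr0 addr0.
  by rewrite !mulr1n rmorphD rmorphN.
rewrite exp_unitary_conj // {1}(hermitian_spectral hrho) -/P.
rewrite !mulmxA -(mulmxA _ P) PPt mulmx1 -(mulmxA (P ^t*)) mulmx_diag.
rewrite mxtrace_unitary_conj // raddf_sum; apply: eq_bigr => i _.
by rewrite !mxE -rmorphXn -rmorphM.
Qed.

Lemma size_eigenvalues A : size (eigenvalues A) = d.
Proof. by rewrite size_sort size_map -cardE card_ord. Qed.

Lemma sum_eigenvalues A (f : R -> R) :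
  \sum_(i < d) f (eigenvalues A)`_i =
  \sum_i f (complex.Re (spectral_diag A 0 i)).
Proof.
have -> : \sum_i f (complex.Re (spectral_diag A 0 i)) =
    \sum_(x <- [seq complex.Re (spectral_diag A 0 i) | i : 'I_d]) f x.
  by rewrite big_map big_enum.
rewrite -(perm_big _ (permEl (perm_sort >=%R _))) -/(eigenvalues A).
by rewrite (big_nth 0) size_eigenvalues big_mkord.
Qed.

Lemma eigenvalues_decreasing A i j :
  (i <= j < d)%N -> (eigenvalues A)`_j <= (eigenvalues A)`_i.
Proof.
move=> /andP[ij jd]; have ge_tr : transitive (>=%R : rel R).
  by move=> x y z /= yx xz; exact: le_trans xz yx.
have := sort_sorted (fun x y : R => le_total y x) [seq complex.Re (spectral_diag A 0 i) | i : 'I_d].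
move/(sorted_leq_nth ge_tr (fun x => lexx x) 0); apply => //.
  by rewrite inE -/(eigenvalues A) size_eigenvalues (leq_ltn_trans ij).
by rewrite inE -/(eigenvalues A) size_eigenvalues.
Qed.

Lemma sum_eigenvalues_density rho : density_matrix rho ->
  \sum_(i < d) (eigenvalues rho)`_i = 1.
Proof.
case=> hrho _; rewrite {1}(hermitian_spectral hrho).
rewrite mxtrace_unitary_conj ?spectral_unitarymx // => /(congr1 (@complex.Re R)).
rewrite (sum_eigenvalues rho id) raddf_sum /= => tr1; rewrite -[RHS]tr1.
by apply: eq_bigr => i _; rewrite mxE.
Qed.

Lemma spectral_diag_ge0 rho i :
  density_matrix rho -> 0 <= complex.Re (spectral_diag rho 0 i).
Proof.
case=> hrho psd _; set P := spectralmx rho.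
have PPt := unitarymxP (spectral_unitarymx rho).
(* Positivity is tested on a unit eigenvector, a row of [P]. *)
suff rowE : (row i P *m rho *m (row i P) ^t* ) 0 0 = (complex.Re (spectral_diag rho 0 i))%:C.
  by have := psd (row i P); rewrite rowE ler0c.
transitivity ((P *m rho *m P ^t* ) i i).
  by rewrite -row_mul !mxE; apply: eq_bigr => j _; rewrite !mxE.
rewrite {1}(hermitian_spectral hrho) -/P !mulmxA PPt mul1mx -mulmxA PPt mulmx1.
by rewrite !mxE eqxx mulr1n.
Qed.

Lemma eigenvalues_ge0 rho i : density_matrix rho -> 0 <= (eigenvalues rho)`_i.
Proof.
(* Beyond the spectrum, [nth] returns the default 0. *)
move=> hrho; have [id|di] := ltnP i d; last by rewrite nth_default ?size_eigenvalues.
have : (eigenvalues rho)`_i \in eigenvalues rho by rewrite mem_nth ?size_eigenvalues.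
by rewrite mem_sort => /mapP[j _ ->]; exact: spectral_diag_ge0.
Qed.

Lemma eigenvalues_le1 rho i : density_matrix rho -> (eigenvalues rho)`_i <= 1.
Proof.
move=> hrho; have [id|di] := ltnP i d; last by rewrite nth_default ?size_eigenvalues.
rewrite -(sum_eigenvalues_density hrho) (bigD1 (Ordinal id)) //= lerDl.
by rewrite sumr_ge0 // => j _; exact: eigenvalues_ge0.
Qed.

(** The constants [(n - 1)^n] cancel in the gap. *)
Lemma moment_gapE rho sigma n : rho \is hermsymmx -> sigma \is hermsymmx ->
  moment_gap rho sigma n =
  \sum_(i < d) (eigenvalues sigma)`_i * (- ln (eigenvalues sigma)`_i + (n%:R - 1)) ^+ n
  - \sum_(i < d) (eigenvalues rho)`_i * (- ln (eigenvalues rho)`_i + (n%:R - 1)) ^+ n.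
Proof.
move=> hrho hsigma; rewrite /moment_gap !entropic_moment_spectral //.
rewrite (sum_eigenvalues sigma (fun x => x * (- ln x + (n%:R - 1)) ^+ n)).
rewrite (sum_eigenvalues rho (fun x => x * (- ln x + (n%:R - 1)) ^+ n)).
by rewrite opprB addrA subrK.
Qed.

Lemma moment_gap_quadratic_ge0 rho sigma (k : R) :
  density_matrix rho -> density_matrix sigma -> majorizes rho sigma ->
  0 <= moment_gap rho sigma 4 - 8 / 3 * k * moment_gap rho sigma 3
       + 2 * (k ^+ 2 - 2 * k) * moment_gap rho sigma 2.
Proof.
move=> drho dsigma maj.
have [hrho _ _] := drho; have [hsigma _ _] := dsigma.
pose H x := x * (moment_poly k).[- ln x].
(* [H] is linear in its polynomial, so its sum splits into the three moment sums. *)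
have HE (s : nat -> R) : \sum_(i < d) H (s i) =
    \sum_(i < d) s i * (- ln (s i) + (4%:R - 1)) ^+ 4
    - 8 / 3 * k * \sum_(i < d) s i * (- ln (s i) + (3%:R - 1)) ^+ 3
    + 2 * (k ^+ 2 - 2 * k) * \sum_(i < d) s i * (- ln (s i) + (2%:R - 1)) ^+ 2.
  rewrite !mulr_sumr -sumrB -big_split; apply: eq_bigr => i _ /=.
  by rewrite /H moment_polyE; move: (s i) (ln (s i)) => x l; ring.
suff : \sum_(i < d) H (eigenvalues rho)`_i <= \sum_(i < d) H (eigenvalues sigma)`_i.
  by rewrite !HE !moment_gapE //; lra.
apply: (karamata (slope := fun y => (moment_poly k - (moment_poly k)^`()).[- ln y])).
- move=> x y; apply: entropic_tangent.
    exact: moment_poly_slope_nd.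
  exact: deriv_moment_poly_ge0.
- move=> x y /andP[x0 xy] y1; apply: moment_poly_slope_nd.
  by rewrite oppr_ge0 ln_le0 // lerN2 ler_ln // ?posrE // (lt_le_trans x0).
- by move=> i _; rewrite eigenvalues_ge0 ?eigenvalues_le1.
- by move=> i j; exact: eigenvalues_decreasing.
- by move=> i _; rewrite eigenvalues_ge0 ?eigenvalues_le1.
(* [majorizes] starts at [m = 1]; at [m = 0] both sums are empty. *)
- by case=> [|m] md; [rewrite !big_ord0 | exact: maj].
- by rewrite !sum_eigenvalues_density.
Qed.

End Spectral.

Theorem mainTheorem6 (R : realType) (d : nat) (rho sigma : 'M[R[i]]_d)
  (hrho : density_matrix rho) (hsigma : density_matrix sigma)
  (hmaj : majorizes rho sigma)
  (hM2 : moment_gap rho sigma 2 <> 0) :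
  moment_gap rho sigma 4 >=
    8 * moment_gap rho sigma 3 - 6 * moment_gap rho sigma 2
    + 8 / 9 * ((moment_gap rho sigma 3 - 3 * moment_gap rho sigma 2) ^+ 2
               / moment_gap rho sigma 2).
Proof.
have q_ge0 k := moment_gap_quadratic_ge0 k hrho hsigma hmaj.
move: (moment_gap rho sigma 2) (moment_gap rho sigma 3) (moment_gap rho sigma 4)
  hM2 q_ge0 => M2 M3 M4 /eqP M2_neq0 q_ge0.
(* At this [k] the quadratic equals the difference of the two sides exactly; [M2_neq0] justifies the
   divisions. *)
rewrite -subr_ge0; have := q_ge0 ((2 * M3 + 3 * M2) / (3 * M2)).
by congr (0 <= _); field.
Qed.
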